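(* Let $L^{\mathrm{trap}}=\{w\in\{0,1\}^*\mid |w|_0=|w|_1=4,\ \delta_{1,1}^{4}(w)\in\{0101,1010,0110,1001\}\ \text{or}\ \delta_{2,2}^{4}(w)\in\{0101,1010,0110,1001\}\}\cup\{00111100,11000011\}$. Then $\mathcal{G}_{L^{\mathrm{trap}}}$ is exactly the class of trapezoid graphs.
   Context: $|w|_a$ is the number of occurrences of letter $a$ in $w$. For a binary word $w$ with four $0$s and four $1$s, $\delta_{1,1}^4(w)$ keeps only the first two $0$s and first two $1$s (deleting the others), and $\delta_{2,2}^4(w)$ keeps only the third and fourth $0$ and the third and fourth $1$. For a word $w$ and distinct letters $a,b$, $h_{a,b}(w)$ replaces $a$ by $0$, $b$ by $1$ and deletes other letters. For $L\subseteq\{0,1\}^*$ closed under exchanging $0$ and $1$ and a word $w$ with letter set $V$, $G(L,w)$ is the graph on $V$ where distinct $u,v$ are adjacent iff $h_{u,v}(w)\in L$; $\mathcal{G}_L$ is the class of graphs isomorphic to some $G(L,w)$. A trapezoid graph is the intersection graph of a family of trapezoids between two fixed parallel lines, each trapezoid being the convex hull of a closed interval on the first line and a closed interval on the second line. *)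

(* Defs.v *)
From HB Require Import structures.
From mathcomp Require Import all_boot all_order all_algebra.
From mathcomp Require Import classical_sets set_interval reals convex.

Set Implicit Arguments.
Unset Strict Implicit.
Unset Printing Implicit Defensive.

Import Order.TTheory GRing.Theory Num.Theory.

Record sgraph := SGraph {
  vertex :> finType;
  adj : rel vertex;
  adj_sym : symmetric adj;
  adj_irr : irreflexive adj }.

Definition isomorphic (G H : sgraph) : Prop :=
  exists2 f : G -> H, bijective f & forall u v, adj (f u) (f v) = adj u v.

(* Binary words are [seq bool], with [false] as the letter 0 and [true] as the
   letter 1; exchanging 0 and 1 is [map negb]. *)
Record exch_lang := ExchLang {
  lang :> pred (seq bool);
  lang_exch : forall w, lang (map negb w) = lang w }.

Section WordGraph.
Variable A : finType.
Implicit Types (a b : A) (w : seq A).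

Definition h a b w : seq bool :=
  pmap (fun x => if x == a then Some false
                 else if x == b then Some true else None) w.

Lemma h_exch a b w : a != b -> h b a w = map negb (h a b w).
Proof.
move=> ab; rewrite /h; elim: w => //= x w IHw.
have [->|xa] := eqVneq x a; first by rewrite (negPf ab) /= IHw.
by case: eqVneq => _ /=; rewrite IHw.
Qed.

Variables (L : exch_lang) (w : seq A).

Definition word_adj : rel (seq_sub w) :=
  fun u v => (u != v) && L (h (val u) (val v) w).

Lemma word_adj_sym : symmetric word_adj.
Proof.
move=> u v; rewrite /word_adj eq_sym; case: eqVneq => //= vu.
by rewrite h_exch // lang_exch.
Qed.

Lemma word_adj_irr : irreflexive word_adj.
Proof. by move=> u; rewrite /word_adj eqxx. Qed.

(* [seq_sub w] is the finite type of the letters occurring in [w]. *)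
Definition word_graph : sgraph := SGraph word_adj_sym word_adj_irr.

End WordGraph.

Definition graph_class (L : exch_lang) (G : sgraph) : Prop :=
  exists (A : finType) (w : seq A), isomorphic G (word_graph L w).

(* [delta i j w] keeps the (2i-1)-th and 2i-th occurrences of 0 and the
   (2j-1)-th and 2j-th occurrences of 1 in [w]: the letter at position [k] is
   preceded by [n] equal letters, hence is the (n+1)-th occurrence, which lies
   in the block number [n./2.+1]. *)
Definition delta (i j : nat) (w : seq bool) : seq bool :=
  [seq nth false w k | k <- iota 0 (size w) &
     (count_mem (nth false w k) (take k w))./2.+1
       == (if nth false w k then j else i)].

Lemma delta_exch i w : delta i i (map negb w) = map negb (delta i i w).
Proof.
rewrite /delta size_map -map_comp.
rewrite (@eq_in_filter _ _ (fun k =>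
  (count_mem (nth false w k) (take k w))./2.+1 == i)) => [|k]; last first.
  rewrite mem_iota => /= kw; rewrite (nth_map false) // -map_take count_map.
  rewrite if_same; congr ((_./2).+1 == _); apply: eq_count => b /=.
  by rewrite (inj_eq negb_inj).
under [in RHS]eq_filter => k do rewrite if_same.
apply/eq_in_map => k; rewrite mem_filter mem_iota => /andP[_ /= kw].
by rewrite (nth_map false).
Qed.

Definition crossing4 : seq (seq bool) :=
  [:: [:: false; true; false; true]; [:: true; false; true; false];
      [:: false; true; true; false]; [:: true; false; false; true]].

Definition Ltrap_pred : pred (seq bool) := fun w =>
  [&& count_mem false w == 4, count_mem true w == 4 &
      (delta 1 1 w \in crossing4) || (delta 2 2 w \in crossing4)]
  || (w \in [:: [:: false; false; true; true; true; true; false; false];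
                [:: true; true; false; false; false; false; true; true]]).

Lemma Ltrap_exch w : Ltrap_pred (map negb w) = Ltrap_pred w.
Proof.
have negbs_inj : injective (map negb) := inj_map negb_inj.
have memN (s : seq (seq bool)) : perm_eq (map (map negb) s) s ->
    forall x, (map negb x \in s) = (x \in s).
  by move=> /perm_mem sN x; rewrite -(mem_map negbs_inj s x) sN.
have countN b : count_mem b (map negb w) = count_mem (~~ b) w.
  by rewrite count_map; apply: eq_count => -[] /=; case: b.
rewrite /Ltrap_pred !delta_exch !memN // !countN /=.
by rewrite andbCA.
Qed.

Definition Ltrap : exch_lang := ExchLang Ltrap_exch.

Section Trapezoids.
Variable R : realType.
Local Open Scope classical_set_scope.
Local Open Scope ring_scope.

Definition plane : lmodType R := (R^o * R^o)%type.

Definition convex_hull (S : set plane) : set plane :=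
  smallest (@convex_set R plane) S.

(* The two fixed parallel lines are y = 0 and y = 1. *)
Record trapezoid := Trapezoid {
  lo1 : R; hi1 : R; lo2 : R; hi2 : R;
  le_lohi1 : lo1 <= hi1;
  le_lohi2 : lo2 <= hi2 }.

Definition region (t : trapezoid) : set plane :=
  convex_hull (`[lo1 t, hi1 t] `*` [set 0] `|` `[lo2 t, hi2 t] `*` [set 1]).

Definition trapezoid_graph (G : sgraph) : Prop :=
  exists t : G -> trapezoid, forall u v : G,
    adj u v <-> u <> v /\ region (t u) `&` region (t v) !=set0.

End Trapezoids.

(* Main.v *)
(** A letter occurring four times in a word [w] is the trapezoid spanned by its
    first two positions on one line and its last two positions on the other.
    Two trapezoids are disjoint iff one lies to the left of the other on both
    lines, and the words of [Ltrap] are exactly those with four 0s and four 1s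
    for which neither letter lies to the left of the other in this sense.
    Letters occurring another number of times are isolated and are placed far
    to the right. Conversely, the endpoints of a family of trapezoids, sorted on
    each line with left endpoints before right ones in case of a tie, are read
    off as a word, first line first. *)
Require Import Defs.
From mathcomp Require Import all_boot reals.
From mathcomp Require Import all_order all_algebra.
From mathcomp Require Import unstable classical_sets convex.
From mathcomp Require Import interval_inference lra.

Set Implicit Arguments.
Unset Strict Implicit.
Unset Printing Implicit Defensive.

Import Order.TTheory GRing.Theory Num.Theory.

(** * Positions of occurrences *)

(* Occurrences are numbered from 0; the value is [size w] when there are at most
   [k] occurrences of [a]. *)
Fixpoint pos (T : eqType) (a : T) (k : nat) (w : seq T) : nat :=
  if w is x :: w' then
    if x == a then if k is k'.+1 then (pos a k' w').+1 else 0
    else (pos a k w').+1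
  else 0.

Section Positions.
Variable T : eqType.
Implicit Types (a b : T) (w : seq T).

Lemma pos_lt_size a k w : k < count_mem a w -> pos a k w < size w.
Proof.
elim: w k => //= x w IHw k; case: eqP => _; last exact: IHw.
by case: k => // k; apply: IHw.
Qed.

Lemma pos_leS a k w : pos a k w <= pos a k.+1 w.
Proof.
elim: w k => //= x w IHw k; case: eqP => _; last exact: IHw.
by case: k => // k; apply: IHw.
Qed.

Lemma pos0_inj a b w : a \in w -> pos a 0 w = pos b 0 w -> a = b.
Proof.
elim: w => //= x w IHw; rewrite inE [a == x]eq_sym.
case: eqP => [<-|_] /=; case: eqP => // _ aw []; exact: IHw.
Qed.

Lemma pos_map (S : eqType) (f : S -> T) a k (x0 : S) s : uniq s ->
  k < size [seq x <- s | f x == a] ->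
  pos a k (map f s) = index (nth x0 [seq x <- s | f x == a] k) s.
Proof.
elim: s k => //= x s IHs k /andP[xs us].
have neq (j : nat) : j < size [seq x <- s | f x == a] ->
    (x == nth x0 [seq x <- s | f x == a] j) = false.
  move=> /(mem_nth x0); rewrite mem_filter => /andP[_ js].
  by apply: contraNF xs => /eqP->.
case: ifP => _; last by move=> ks; rewrite neq // IHs.
by case: k => [|k] /=; [rewrite eqxx | move=> ks; rewrite neq // IHs].
Qed.

End Positions.

(** * Projection to two letters *)

Section Projection.
Variables (A : finType) (a b : A).
Hypothesis ab : a != b.
Implicit Type w : seq A.

Lemma count_h0 w : count_mem false (h a b w) = count_mem a w.
Proof.
by elim: w => //= x w; do 2?case: eqP => _ //=; rewrite ?add1n => ->.
Qed.

Lemma count_h1 w : count_mem true (h a b w) = count_mem b w.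
Proof.
elim: w => //= x w; case: eqP => [->|_] /=; first by rewrite (negPf ab).
by case: eqP => _ //= ->.
Qed.

(** Erasing the other letters keeps the order of the rest, and a missing occurrence sits at the end
    of the word both before and after the projection. *)
Lemma ltn_pos_h01 k l w :
  (pos false k (h a b w) < pos true l (h a b w)) = (pos a k w < pos b l w).
Proof.
elim: w k l => //= x w IHw k l.
have [->|_] := eqVneq x a.
  by rewrite (negPf ab) /=; case: k => // k; apply: IHw.
by case: eqP => _ /=; [case: l => // l|]; apply: IHw.
Qed.

Lemma ltn_pos_h10 k l w :
  (pos true l (h a b w) < pos false k (h a b w)) = (pos b l w < pos a k w).
Proof.
elim: w k l => //= x w IHw k l.
have [->|_] := eqVneq x a.
  by rewrite (negPf ab) /=; case: k => // k; apply: IHw.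
by case: eqP => _ /=; [case: l => // l|]; apply: IHw.
Qed.

End Projection.

(** * The language [Ltrap] in terms of positions *)

(** Counting from 0, occurrences 0 and 1 are the left and right ends on the first line, 2 and 3
    those on the second. *)
Definition leftw (T : eqType) (w : seq T) (a b : T) : bool :=
  (pos a 1 w < pos b 0 w) && (pos a 3 w < pos b 2 w).

Fixpoint words (n : nat) : seq (seq bool) :=
  if n is n'.+1 then map (cons false) (words n') ++ map (cons true) (words n')
  else [:: [::]].

Lemma mem_words (b : seq bool) : b \in words (size b).
Proof.
elim: b => //= c b IHb; rewrite mem_cat; apply/orP.
by case: c; [right|left]; apply: map_f.
Qed.

(** Two 0s and two 1s cross unless they form 0011 or 1100. When neither block crosses, equal orders
    give [leftw], and opposite orders force 00111100 or 11000011. *)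
Lemma Ltrap_binary (b : seq bool) :
  Ltrap b = [&& count_mem false b == 4, count_mem true b == 4
              & ~~ (leftw b false true || leftw b true false)].
Proof.
have [b8|b8] := boolP ((count_mem false b == 4) && (count_mem true b == 4)).
  have sb : size b = 8.
    have := count_predC (pred1 false) b.
    rewrite (@eq_count _ (predC _) (pred1 true)); last by case.
    by case/andP: b8 => /eqP-> /eqP->.
  (* Only the 256 words of length 8 remain, and they are checked by computation. *)
  apply/eqP; have := mem_words b; rewrite sb; move: {b8 sb} b.
  by apply/allP; vm_compute.
rewrite andbA (negPf b8) /= /Ltrap_pred andbA (negPf b8) /= !inE.
by apply/negbTE; apply: contra b8 => /orP[] /eqP->.
Qed.

Lemma Ltrap_h (A : finType) (a b : A) (w : seq A) : a != b ->
  Ltrap (h a b w) = [&& count_mem a w == 4, count_mem b w == 4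
                      & ~~ (leftw w a b || leftw w b a)].
Proof.
move=> ab; rewrite Ltrap_binary count_h0 // count_h1 //.
by rewrite /leftw !ltn_pos_h01 // !ltn_pos_h10.
Qed.

(** * Intersection of trapezoids *)

Section Regions.
Variable R : realType.
Local Open Scope classical_set_scope.
Local Open Scope ring_scope.
Implicit Types s t : trapezoid R.

Definition left_of s t : bool := (hi1 s < lo1 t) && (hi2 s < lo2 t).

(** The set cut out by these inequalities is convex and contains both bases, hence contains their
    hull. *)
Lemma region_bounds t (p : plane R) : region t p ->
  [/\ 0 <= p.2 <= 1,
      (1 - p.2) * lo1 t + p.2 * lo2 t <= p.1
    & p.1 <= (1 - p.2) * hi1 t + p.2 * hi2 t].
Proof.
move: p; rewrite /region /convex_hull.
pose B : set (plane R) := [set p | [/\ 0 <= p.2 <= 1,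
      (1 - p.2) * lo1 t + p.2 * lo2 t <= p.1
    & p.1 <= (1 - p.2) * hi1 t + p.2 * hi2 t]].
apply: (@smallest_sub _ _ _ B).
  move=> [x1 x2] [y1 y2] k; rewrite !inE /B /= => -[x01 lx xh] [y01 ly yh].
  have k0 : 0 <= k%:num by [].
  have k1 : k%:num <= 1 by [].
  rewrite /conv /= /GRing.scale /= /onem.
  move: (k%:num) k0 k1 => c c0 c1; have d0 : 0 <= 1 - c by rewrite subr_ge0.
  split.
  - case/andP: x01 => x20 x21; case/andP: y01 => y20 y21.
    by apply/andP; split; nra.
  - have := ler_wpM2l c0 lx; have := ler_wpM2l d0 ly; lra.
  - have := ler_wpM2l c0 xh; have := ler_wpM2l d0 yh; lra.
move=> [x y] [] [] /=; rewrite in_itv /= => /andP[lx xh] -> /=.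
  by rewrite /B /= subr0 !mul1r !mul0r !addr0 lexx ler01.
by rewrite /B /= subrr !mul1r !mul0r !add0r lexx ler01.
Qed.

Lemma region_segment t (a b y : R) :
  lo1 t <= a <= hi1 t -> lo2 t <= b <= hi2 t -> 0 <= y <= 1 ->
  region t ((1 - y) * a + y * b, y).
Proof.
move=> ta tb /andP[y0 y1] C [cC subC].
have Ca : ((a, 0) : plane R) \in C.
  by rewrite inE; apply: subC; left; rewrite /= in_itv.
have Cb : ((b, 1) : plane R) \in C.
  by rewrite inE; apply: subC; right; rewrite /= in_itv.
have := cC _ _ (Itv01 y0 y1) Cb Ca; rewrite inE /conv /= /GRing.scale /= /onem.
congr (C _); congr pair; first exact: addrC.
rewrite -[RHS]addr0 -[X in X + _ = _]/(y * 1).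
by rewrite -[X in _ + X = _]/((1 - y) * 0) mulr1 mulr0.
Qed.

Lemma region_left_disjoint s t : left_of s t ->
  ~ (region s `&` region t !=set0).
Proof.
move=> /andP[st1 st2] [[x y]] [/region_bounds/= [/andP[y0 y1] _ xs]].
move=> /region_bounds/= [_ tx _]; have := le_trans tx xs; apply/negP.
(* The gap on the second line has weight [y], so at height 0 strictness must come from the first
   line. *)
rewrite -ltNge; move: y0; rewrite le_eqVlt => /predU1P[<-|y0].
  by rewrite subr0 !mul1r !mul0r !addr0.
apply: ler_ltD; first by rewrite ler_wpM2l ?subr_ge0 // ltW.
by rewrite ltr_pM2l.
Qed.

Lemma region_cross s t : hi1 s < lo1 t -> hi2 t < lo2 s ->
  region s `&` region t !=set0.
Proof.
move=> st1 ts2; pose d1 := lo1 t - hi1 s; pose d2 := lo2 s - hi2 t.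
have d1_gt0 : 0 < d1 by rewrite subr_gt0.
have d2_gt0 : 0 < d2 by rewrite subr_gt0.
have d_gt0 : 0 < d1 + d2 by apply: addr_gt0.
(* Between the segments from [hi1 s] to [lo2 s] and from [lo1 t] to [hi2 t], the gap runs linearly
   from [d1] to [- d2] and vanishes at this height. *)
pose y := d1 / (d1 + d2).
have y01 : 0 <= y <= 1.
  apply/andP; split; first by apply: divr_ge0; apply: ltW.
  by rewrite /y ler_pdivrMr // mul1r lerDl ltW.
exists ((1 - y) * hi1 s + y * lo2 s, y); split.
  by apply: region_segment; rewrite ?lexx ?le_lohi1 ?le_lohi2.
have -> : (1 - y) * hi1 s + y * lo2 s = (1 - y) * lo1 t + y * hi2 t.
  have : y * (d1 + d2) = d1 by rewrite divfK // gt_eqF.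
  rewrite /d1 /d2; lra.
by apply: region_segment; rewrite ?lexx ?le_lohi1 ?le_lohi2.
Qed.

Lemma itv_meet (a b c d : R) : a <= b -> c <= d -> c <= b -> a <= d ->
  exists x, a <= x <= b /\ c <= x <= d.
Proof.
move=> ab cd cb ad; exists (Num.max a c).
by rewrite !le_max !ge_max !lexx ab cd cb ad orbT.
Qed.

(** If neither lies left of the other, either the intervals on one line overlap, or their orders on
    the two lines are opposite and the trapezoids cross. *)
Lemma region_meetP s t :
  region s `&` region t !=set0 <-> ~~ (left_of s t || left_of t s).
Proof.
split=> [st|].
  apply/norP; split; apply/negP => /region_left_disjoint; first exact.
  by rewrite setIC.
rewrite /left_of.
have [st1|ts1] := ltP (hi1 s) (lo1 t).
  have [//|ts2] := ltP (hi2 s) (lo2 t).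
  have [ts3 _|st3 _] := ltP (hi2 t) (lo2 s); first exact: region_cross.
  have [x [xs xt]] := itv_meet (le_lohi2 s) (le_lohi2 t) ts2 st3.
  (* At height 1 the point on the first line has weight 0, so [hi1 s] is an arbitrary choice. *)
  exists ((1 - 1) * hi1 s + 1 * x, 1); split.
    by apply: region_segment; rewrite ?lexx ?le_lohi1 ?ler01.
  have -> : (1 - 1) * hi1 s + 1 * x = (1 - 1) * hi1 t + 1 * x by lra.
  by apply: region_segment; rewrite ?lexx ?le_lohi1 ?ler01.
have [ts3|st3 _] := ltP (hi1 t) (lo1 s); last first.
  have [x [xs xt]] := itv_meet (le_lohi1 s) (le_lohi1 t) ts1 st3.
  exists ((1 - 0) * x + 0 * hi2 s, 0); split.
    by apply: region_segment; rewrite ?lexx ?le_lohi2 ?ler01.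
  have -> : (1 - 0) * x + 0 * hi2 s = (1 - 0) * x + 0 * hi2 t by lra.
  by apply: region_segment; rewrite ?lexx ?le_lohi2 ?ler01.
have [//|st2 _] := ltP (hi2 t) (lo2 s).
have [ts2|ts2] := ltP (hi2 s) (lo2 t).
  by rewrite setIC; apply: region_cross.
have [x [xs xt]] := itv_meet (le_lohi2 s) (le_lohi2 t) ts2 st2.
exists ((1 - 1) * hi1 s + 1 * x, 1); split.
  by apply: region_segment; rewrite ?lexx ?le_lohi1 ?ler01.
have -> : (1 - 1) * hi1 s + 1 * x = (1 - 1) * hi1 t + 1 * x by lra.
by apply: region_segment; rewrite ?lexx ?le_lohi1 ?ler01.
Qed.

End Regions.

(** * From words to trapezoids *)

Section WordTrapezoids.
Variables (R : realType) (A : finType) (w : seq A).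
Local Open Scope ring_scope.

(** Without exactly four occurrences all corners coincide, beyond every position; the offset
    [pos a 0 w] separates such letters from one another. *)
Definition corner (a : A) (k : nat) : nat :=
  if count_mem a w == 4 then pos a k w else size w + pos a 0 w.

Lemma corner_leS a k : (corner a k)%:R <= (corner a k.+1)%:R :> R.
Proof. by rewrite ler_nat /corner; case: ifP => // _; apply: pos_leS. Qed.

Definition word_trapezoid (a : A) : trapezoid R :=
  Trapezoid (corner_leS a 0) (corner_leS a 2).

Lemma left_of_word_trapezoid a b :
  left_of (word_trapezoid a) (word_trapezoid b) =
  (corner a 1 < corner b 0)%N && (corner a 3 < corner b 2)%N.
Proof. by rewrite /left_of /= !ltr_nat. Qed.

Lemma Ltrap_word_trapezoid a b : a \in w -> b \in w -> a != b ->
  Ltrap (h a b w) = ~~ (left_of (word_trapezoid a) (word_trapezoid b)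
                        || left_of (word_trapezoid b) (word_trapezoid a)).
Proof.
move=> aw bw ab; rewrite Ltrap_h // !left_of_word_trapezoid /corner.
have lt4 c k : count_mem c w = 4 -> (k < 4)%N ->
    forall n, (pos c k w < size w + n)%N.
  by move=> c4 k4 n; rewrite ltn_addr // pos_lt_size ?c4.
case: eqP => [a4|_]; case: eqP => [b4|_] //=; rewrite ?lt4 ?orbT //.
(* Neither letter occurs four times: their first occurrences differ, so one lies left of the
   other. *)
rewrite !ltn_add2l !andbb -neq_ltn; case: eqP => // /pos0_inj E.
by rewrite E ?eqxx in ab.
Qed.

End WordTrapezoids.

(** * From trapezoids to words *)

Section TrapezoidWord.
Variables (R : realType) (V : finType) (t : V -> trapezoid R).

Definition endpoint (e : V * nat) : R :=
  nth 0%R [:: lo1 (t e.1); hi1 (t e.1); lo2 (t e.1); hi2 (t e.1)] e.2.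

(** Lines first, then abscissas; parity breaks ties so that touching closed intervals are not read
    as disjoint. *)
Definition key (e : V * nat) : (nat *l R) *l bool :=
  ((e.2./2, endpoint e), odd e.2).

Definition before : rel (V * nat) := relpre key <=%O.

Lemma before_total : total before.
Proof. by move=> e e'; apply: le_total. Qed.

Lemma before_trans : transitive before.
Proof. by move=> e e' e''; apply: le_trans. Qed.

Definition events : seq (V * nat) := [seq (v, k) | v <- enum V, k <- iota 0 4].

Definition sorted_events : seq (V * nat) := sort before events.

Definition trapezoid_word : seq V := map fst sorted_events.

Lemma mem_events v k : ((v, k) \in events) = (k < 4).
Proof.
apply/allpairsPdep/idP => [[u [l [_]]]|k4].
  by rewrite mem_iota => l4 [_ ->].
by exists v, k; rewrite mem_enum mem_iota.
Qed.

Lemma events_uniq : uniq events.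
Proof.
apply: allpairs_uniq; rewrite ?enum_uniq ?iota_uniq //.
by move=> [u k] [v l] _ _ [-> ->].
Qed.

Lemma filter_events v :
  [seq e <- events | e.1 == v] = [seq (v, k) | k <- iota 0 4].
Proof.
rewrite /events; have: v \in enum V by rewrite mem_enum.
have := enum_uniq V; elim: (enum V) => //= u s IHs /andP[us ss].
rewrite inE; have [->|vu] /= := eqVneq v u.
  move=> _; do 4 congr cons.
  rewrite -[RHS](filter_pred0 [seq (x, k) | x <- s, k <- iota 0 4]).
  apply: eq_in_filter => e /flatten_mapP[x xs].
  rewrite !inE => /or4P xe.
  have {xe} -> : e.1 = x by case: xe => /eqP->.
  by apply: contraNF us => /eqP<-.
exact: IHs.
Qed.

(** Sorting commutes with filtering, and the endpoints of one trapezoid are already in order. Hence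
    occurrence [k] of [v] is its endpoint [k]. *)
Lemma filter_sorted_events v :
  [seq e <- sorted_events | e.1 == v] = [seq (v, k) | k <- iota 0 4].
Proof.
rewrite /sorted_events filter_sort; [|exact: before_total|exact: before_trans].
rewrite filter_events sorted_sort //; first exact: before_trans.
rewrite /= /before /= !lexi_pair /= /endpoint /=.
by rewrite le_lohi1 le_lohi2 /= !implybT.
Qed.

Lemma count_trapezoid_word v : count_mem v trapezoid_word = 4.
Proof.
by rewrite count_map -size_filter /preim /= filter_sorted_events.
Qed.

Lemma pos_trapezoid_word v k : k < 4 ->
  pos v k trapezoid_word = index (v, k) sorted_events.
Proof.
move=> k4; rewrite (pos_map (v, 0)) ?sort_uniq ?events_uniq //.
  by rewrite filter_sorted_events (nth_map 0) ?size_iota // nth_iota.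
by rewrite filter_sorted_events size_map size_iota.
Qed.

(** Distinct events may share a key, so only a strict inequality of keys determines their order. *)
Lemma index_key_lt e e' : e \in events -> e' \in events ->
  (key e < key e')%O -> index e sorted_events < index e' sorted_events.
Proof.
move=> ee ee' lt_ee'; rewrite ltnNge leq_eqVlt negb_or; apply/andP; split.
  apply: contraTneq lt_ee' => eq_ee'.
  by rewrite (index_inj _ _ _ eq_ee') ?mem_sort // ltxx.
have := sorted_ltn_index before_trans (sort_sorted before_total events).
move=> /(_ e' e); rewrite !mem_sort ee ee' => /(_ isT isT) le_e'e.
by apply/negP => /le_e'e; rewrite /before /= leNgt lt_ee'.
Qed.

Lemma ltn_pos_trapezoid_word u v k l : k < 4 -> l < 4 ->
  k./2 = l./2 -> odd k -> ~~ odd l ->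
  (pos u k trapezoid_word < pos v l trapezoid_word)
  = (endpoint (u, k) < endpoint (v, l))%R.
Proof.
move=> k4 l4 kl ok ol; rewrite !pos_trapezoid_word //.
case: ltP => [lt_uv|le_vu].
  apply: index_key_lt; rewrite ?mem_events // /key ltxi_pair !lexi_pair.
  by rewrite [_.2]/= [(v, l).2]/= kl lexx /= (ltW lt_uv) leNgt lt_uv.
(* On a tie, parity still puts the left end [(v, l)] strictly first. *)
apply/negbTE; rewrite -leqNgt ltnW //.
apply: index_key_lt; rewrite ?mem_events // /key ltxi_pair !lexi_pair.
by rewrite [_.2]/= [(u, k).2]/= kl lexx /= le_vu ok (negPf ol) implybT.
Qed.

Lemma leftw_trapezoid_word u v : leftw trapezoid_word u v = left_of (t u) (t v).
Proof. by rewrite /leftw !ltn_pos_trapezoid_word. Qed.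

End TrapezoidWord.

(** * Equality of the two graph classes *)

Theorem theorem5 (R : realType) (G : sgraph) :
  graph_class Ltrap G <-> trapezoid_graph R G.
Proof.
split=> [[A [w [f /bij_inj f_inj f_adj]]]|[t t_adj]].
  exists (fun u => word_trapezoid R w (val (f u))) => u v.
  rewrite region_meetP -f_adj /= /word_adj (inj_eq f_inj).
  have [->|uv] /= := eqVneq u v; first by split=> // -[].
  rewrite -Ltrap_word_trapezoid ?ssvalP ?(inj_eq val_inj) ?(inj_eq f_inj) //.
  by split=> [|[]]; first by split=> //; apply/eqP.
exists G, (trapezoid_word t).
have inw v : v \in trapezoid_word t.
  by rewrite -has_pred1 has_count count_trapezoid_word.
exists (fun v => SeqSub (inw v)); first by exists val => // v; apply: val_inj.
move=> u v; rewrite /= /word_adj -val_eqE /=.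
have [->|uv] /= := eqVneq u v; first by rewrite adj_irr.
rewrite [LHS](Ltrap_h _ uv) !count_trapezoid_word !leftw_trapezoid_word /=.
apply/idP/idP => [st|/t_adj[_ /region_meetP //]].
by apply/t_adj; split; [apply/eqP|apply/region_meetP].
Qed.
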